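(* Let $Q$ be a quantale. Then the quantale space $\mathcal I_Q^{+}$ of all proper ideals of $Q$ is a spectral space.
   Context: A quantale here means a complete lattice $(Q,\preccurlyeq,\bot,\top)$ with a binary operation $\&$ that is associative, commutative, satisfies $x\&\bigl(\bigvee_{\lambda} y_\lambda\bigr)=\bigvee_\lambda (x\& y_\lambda)$ for all families, and satisfies $x\&\top=x$ for all $x$. An ideal of $Q$ is a nonempty subset $I\subseteq Q$ such that $x,y\in I$ implies $x\vee y\in I$, and $x\in I$, $l\preccurlyeq x$ imply $l\in I$. $\mathcal I_Q$ is the set of all ideals of $Q$ and $\mathcal I_Q^{+}$ the set of proper ideals ($I\neq Q$). For a set $\Sigma_Q$ of proper ideals of $Q$ and $X\subseteq \mathcal I_Q$, put $X^{\uparrow}=\{J\in\Sigma_Q\mid \bigcap X\subseteq J\}$ if $X\neq\emptyset$ and $\emptyset^{\uparrow}=\emptyset$. The quantale topology on $\Sigma_Q$ is the topology having the sets $X^{\uparrow}$ ($X\subseteq \mathcal I_Q$) as a subbasis of closed sets; $\Sigma_Q$ with this topology is called a quantale space. A topological space is spectral if it is quasi-compact, sober (every non-empty irreducible closed subset is the closure of a unique point), and admits a basis of quasi-compact open subspaces that is closed under finite intersections. Quasi-compact means every open cover has a finite subcover. *)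

(* Defs.v *)
From HB Require Import structures.
From mathcomp Require Import all_boot all_order.
From mathcomp Require Import boolp classical_sets functions cardinality filter.
From mathcomp Require Import topology.
Set Implicit Arguments.
Unset Strict Implicit.
Unset Printing Implicit Defensive.
Import Order.TTheory.
Local Open Scope classical_set_scope.

(* [qsup A] is the join of an arbitrary subset [A]; a poset with all joins is a
   complete lattice.  The join of a family is the join of its range, so
   distributivity over families is stated on direct images. *)
HB.mixin Record isQuantale d Q & Order.TBLattice d Q := {
  qsup : set Q -> Q ;
  qsupP : forall A : set Q, supremums A (qsup A) ;
  qmul : Q -> Q -> Q ;
  qmulA : associative qmul ;
  qmulC : commutative qmul ;
  qmul_supr : forall (x : Q) (A : set Q), qmul x (qsup A) = qsup (qmul x @` A) ;
  qmulx1 : forall x : Q, qmul x \top%O = x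
}.

#[short(type="quantaleType")]
HB.structure Definition Quantale d := {Q of isQuantale d Q & Order.TBLattice d Q}.

Section Ideals.
Context {d : Order.disp_t} (Q : quantaleType d).

Definition is_ideal (I : set Q) : Prop :=
  [/\ I !=set0,
      (forall x y, I x -> I y -> I (x `|` y)%O) &
      (forall x l, I x -> (l <= x)%O -> I l)].

Definition ideals : set (set Q) := [set I | is_ideal I].

Definition proper_ideals : set (set Q) := [set I | is_ideal I /\ I <> setT].

End Ideals.

Arguments ideals {d} Q.
Arguments proper_ideals {d} Q.

Section QuantaleSpace.
Context {d : Order.disp_t} {Q : quantaleType d}.

(* The points are the elements of [Sigma], meant to be a set of proper ideals.
   This is an alias of the subtype, so that its topology is the one declared
   below. *)
Definition quantale_space (Sigma : set (set Q)) : Type := set_type Sigma.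

HB.instance Definition _ (Sigma : set (set Q)) :=
  Choice.on (quantale_space Sigma).

Context (Sigma : set (set Q)).

(* [up set0] is [set0] by convention, whatever [Sigma] is. *)
Definition up (X : set (set Q)) : set (quantale_space Sigma) :=
  [set J | X !=set0 /\ \bigcap_(I in X) I `<=` val J].

(* Subbasis of closed sets: their complements form a subbasis of open sets. *)
HB.instance Definition _ := @isSubBaseTopological.Build (quantale_space Sigma)
  (set (set Q)) [set X | X `<=` ideals Q] (fun X => ~` up X).

End QuantaleSpace.

Section Spectral.
Context (T : topologicalType).

Definition irreducible_set (Z : set T) : Prop :=
  Z !=set0 /\
  forall A B : set T, closed A -> closed B ->
    Z `<=` A `|` B -> Z `<=` A \/ Z `<=` B.

Definition sober : Prop :=
  forall Z : set T, closed Z -> irreducible_set Z ->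
    exists! x : T, closure [set x] = Z.

(* Taking [F] empty, the last clause includes the empty intersection [setT]. *)
Definition has_coherent_basis : Prop :=
  exists B : set (set T),
    [/\ basis B,
        (forall U, B U -> cover_compact U) &
        (forall F : set (set T), finite_set F -> F `<=` B ->
           B (\bigcap_(U in F) U))].

Definition spectral : Prop :=
  [/\ cover_compact [set: T], sober & has_coherent_basis].

End Spectral.

(* Main.v *)
(** An ideal contains the intersection of a nonempty family of ideals iff it
    contains each principal ideal inside that intersection.  So the topology has
    the basic open sets [{J | J misses A}], [A] a finite subset of [Q].  Being an
    ideal, missing [A] and missing the top are conditions involving finitely many
    elements at a time; hence they pass to ultrafilter limits, which gives
    quasi-compactness.  The intersection of an irreducible closed set [Z] of
    ideals is again in [Z], and is its generic point, since [K] is in the closure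
    of [{J}] iff [J] is included in [K]. *)
Require Import Defs.
From mathcomp Require Import all_boot all_order.
From mathcomp Require Import finmap boolp classical_sets cardinality.
From mathcomp Require Import filter topology.
Set Implicit Arguments.
Unset Strict Implicit.
Unset Printing Implicit Defensive.
Import Order.TTheory.
Local Open Scope classical_set_scope.

(* [compact_cover] asks for a pointed space, but there are no proper ideals when
   [\bot = \top] in [Q]. *)
Lemma compact_cover_compact (T : topologicalType) (A : set T) :
  compact A -> cover_compact A.
Proof.
move=> Aco I D f fop Af; apply: contrapT => nfin.
(* Generated by the complements in [A] of finite subunions; it is proper because no finite subfamily
   covers [A]. A cluster point would lie in some [f i], although [F] contains the part of [A]
   outside [f i]. *)
pose F := filter_from [set X : {fset I} | {subset X <= D}]
  (fun X => A `\` cover [set` X] f).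
have FF : ProperFilter F.
  apply: filter_from_proper; first apply: filter_from_filter.
  - by exists fset0.
  - move=> X Y XD YD; exists (X `|` Y)%fset.
      by move=> i; rewrite inE => /orP[/XD|/YD].
    by move=> x [Ax nx]; split; split=> // -[i Xi fx]; apply: nx;
      exists i => //=; rewrite inE Xi ?orbT.
  - move=> X XD; apply: contrapT => nX; apply: nfin; exists X => // x Ax.
    by apply: contrapT => nx; apply: nX; exists x.
have FA : F A by exists fset0 => // x [].
have [x [Ax xF]] := Aco F FF FA.
have [i Di fx] := Af x Ax.
have Fi : F (A `\` f i).
  exists [fset i]%fset => [j|y [Ay ny]]; first by rewrite !inE => /eqP ->.
  by split=> // fy; apply: ny; exists i => //=; rewrite inE.
have [y [[_ nfy] fy]] : (A `\` f i) `&` f i !=set0.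
  by apply: xF => //; apply: open_nbhs_nbhs; split=> //; exact: fop.
exact: nfy.
Qed.

Section Avoid.
Context {d : Order.disp_t} {Q : quantaleType d} (Sigma : set (set Q)).

Local Notation space := (quantale_space Sigma).

Definition avoid (A : set Q) : set space :=
  [set J | forall a, A a -> ~ val J a].

Lemma avoid0 : avoid set0 = setT.
Proof. by rewrite -subTset => J _ a. Qed.

Lemma avoid_bigcup (I : Type) (D : set I) (A : I -> set Q) :
  avoid (\bigcup_(i in D) A i) = \bigcap_(i in D) avoid (A i).
Proof.
apply/seteqP; split=> [J JA i Di a Aia|J JA a [i Di Aia]].
  by apply: JA; exists i.
exact: JA Aia.
Qed.

Lemma avoidE (A : set Q) : avoid A = \bigcap_(a in A) avoid [set a].
Proof. by rewrite -avoid_bigcup bigcup_imset1 image_id. Qed.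

(** Serves for three filters: the neighbourhoods of a point, an ultrafilter, and the open traces on
    an irreducible set. *)
Lemma filter_avoid (F : set_system space) (A : set Q) : Filter F ->
  finite_set A -> (forall a, A a -> F (avoid [set a])) -> F (avoid A).
Proof.
move=> FF /finite_fsetP[X ->] FX; rewrite avoidE.
by apply: filter_bigI => a; exact: FX.
Qed.

Lemma open_avoid_sub (U : set space) (J : space) : open U -> U J ->
  exists A, [/\ finite_set A, avoid A J & avoid A `<=` U].
Proof.
move=> [D' D'fin <-] [V /[dup] D'V /D'fin[X Xid XV] VJ].
have /choice[g gP] : forall Y : set (set Q), exists A : set Q, Y \in X ->
    [/\ finite_set A, avoid A J & avoid A `<=` ~` @up _ _ Sigma Y].
  move=> Y; have [YX|?] := boolP (Y \in X); last by exists set0.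
  have nup : ~ @up _ _ Sigma Y J by move: VJ; rewrite -XV; apply.
  (* For empty [Y], [up Y] is empty by convention, so missing nothing suffices; otherwise one
     element of the intersection of [Y] outside [J] is enough. *)
  have [Y0|Y0] := pselect (Y !=set0); last first.
    by exists set0 => _; split=> [//||K _ [/Y0//]]; rewrite avoid0.
  have [a [Ya Ja]] : exists a, (\bigcap_(I in Y) I) a /\ ~ val J a.
    apply: contrapT => na; apply: nup; split=> // a Ya.
    by apply: contrapT => Ja; apply: na; exists a.
  exists [set a] => _; split; [exact: finite_set1|by move=> _ ->|].
  by move=> K Ka [_ /(_ _ Ya)]; exact: Ka.
exists (\bigcup_(Y in [set` X]) g Y); split.
- by apply: bigcup_finite => // Y /gP[].
- by rewrite avoid_bigcup => Y /gP[].
- rewrite avoid_bigcup => K Kg; exists V => //=.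
  rewrite -XV => Y YX.
  by have [_ _] := gP Y YX; apply; exact: Kg.
Qed.

Hypothesis Sigma_ideals : Sigma `<=` ideals Q.

Lemma space_ideal (J : space) : is_ideal (val J).
Proof. by apply: Sigma_ideals; apply: set_mem; exact: valP. Qed.

Lemma open_avoid1 (a : Q) : open (avoid [set a]).
Proof.
(* The only member is the principal ideal of [a], which an ideal includes iff it contains [a]. *)
pose Y : set (set Q) := [set [set x | (x <= a)%O]].
have Yid : Y `<=` ideals Q.
  move=> _ ->; split; first by exists a => /=.
    by move=> x y /=; rewrite leUx => -> ->.
  by move=> x l /= xa lx; exact: le_trans xa.
have -> : avoid [set a] = ~` @up _ _ Sigma Y.
  apply/seteqP; split=> J /=.
    by move=> Ja [_ YJ]; apply: (Ja a) => //; apply: YJ => _ ->; exact: lexx.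
  move=> nJ _ -> Ja; apply: nJ; split; first by exists [set x | (x <= a)%O].
  move=> x /(_ _ erefl) /= xa; have [_ _ down] := space_ideal J.
  exact: down xa.
exists [set ~` @up _ _ Sigma Y]; last by rewrite bigcup_set1.
by move=> _ ->; apply: (@finI_from1 (set (set Q))).
Qed.

Lemma open_avoid (A : set Q) : finite_set A -> open (avoid A).
Proof.
move=> Afin; rewrite openE => J JA; apply: filter_avoid => // a Aa.
apply: open_nbhs_nbhs; split; first exact: open_avoid1.
by move=> _ ->; exact: JA.
Qed.

Lemma basis_avoid : basis [set avoid A | A in [set A | finite_set A]].
Proof.
split=> [_ [A /= Afin <-]|J U /=]; first exact: open_avoid.
rewrite nbhsE => -[O [Oop OJ] OU].
have [A [Afin JA AO]] := open_avoid_sub Oop OJ.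
by exists (avoid A) => //; [split=> //; exists A|exact: subset_trans OU].
Qed.

Lemma closure1_specialization (J : space) :
  closure [set J] = [set K | val J `<=` val K].
Proof.
apply/seteqP; split=> [K JK a Ja|K JK U].
  apply: contrapT => nKa.
  have /JK[_ [-> /(_ _ erefl)//]] : nbhs K (avoid [set a]).
  by apply: open_nbhs_nbhs; split; [exact: open_avoid1|move=> _ ->].
rewrite nbhsE => -[O [Oop OK] OU].
have [A [_ KA AO]] := open_avoid_sub Oop OK.
exists J; split=> //; apply/OU/AO => a Aa Ja.
by apply: (KA a Aa); exact: JK.
Qed.

End Avoid.

Section Irreducible.
Context (T : topologicalType) (Z : set T).

(* For irreducible [Z] this is a filter, so that [filter_avoid] yields a point of
   [Z] missing a finite set [A] from points of [Z] missing each element of [A]. *)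
Definition open_traces : set_system T :=
  filter_from [set O | open O /\ Z `&` O !=set0] id.

(** If two open sets meeting [Z] had no common point in [Z], their closed complements would cover
    [Z], against irreducibility. *)
Lemma irreducible_open_traces : irreducible_set Z -> Filter open_traces.
Proof.
move=> [[z Zz] Zirr]; apply: filter_from_filter.
  by exists setT; split; [exact: openT|exists z].
move=> U V [Uop [u [Zu Uu]]] [Vop [v [Zv Vv]]]; exists (U `&` V) => //.
split; first exact: openI.
apply: contrapT => UV0.
have [||x Zx|ZU|ZV] := Zirr (~` U) (~` V).
- exact: open_closedC.
- exact: open_closedC.
- by rewrite -setCI => UVx; apply: UV0; exists x.
- exact: (ZU u).
- exact: (ZV v).
Qed.

End Irreducible.

Section ProperIdeals.
Context {d : Order.disp_t} {Q : quantaleType d}.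

Local Notation space := (quantale_space (proper_ideals Q)).

Lemma proper_ideals_sub : proper_ideals Q `<=` ideals Q.
Proof. by move=> I []. Qed.

Lemma ideal_bot (I : set Q) : is_ideal I -> I \bot%O.
Proof. by move=> [[x Ix] _ down]; apply: down Ix _; exact: le0x. Qed.

(** Turns properness into a condition on one element, which passes to ultrafilter limits and
    nonempty intersections. *)
Lemma proper_idealE (I : set Q) :
  proper_ideals Q I <-> is_ideal I /\ ~ I \top%O.
Proof.
split=> -[Iid Iprop]; split=> //; last by move=> IT; apply: Iprop; rewrite IT.
move=> IT; apply: Iprop; apply/seteqP; split=> // x _.
by have [_ _ down] := Iid; apply: down IT _; exact: lex1.
Qed.

Lemma space_proper (J : space) : proper_ideals Q (val J).
Proof. by apply: set_mem; exact: valP. Qed.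

Lemma cover_compact_avoid (A : set Q) :
  cover_compact (avoid A : set space).
Proof.
apply: compact_cover_compact.
rewrite compact_ultra => F FU FA.
(* The limit of [F]: the elements belonging to [F]-almost every ideal. *)
pose L : set Q := [set q | F [set K : space | val K q]].
have LP : proper_ideals Q L.
  apply/proper_idealE; split; first split.
  - exists \bot%O; apply: filterS filterT => K _.
    by apply: ideal_bot; exact: (space_proper K).1.
  - move=> x y Lx Ly; apply: filterS2 Lx Ly => K.
    by have [[_ join _] _] := space_proper K; exact: join.
  - move=> x l Lx lx; apply: filterS Lx => K Kx.
    by have [[_ _ down] _] := space_proper K; exact: down lx.
  - move=> /filter_ex[K KT].
    by have /proper_idealE[_] := space_proper K.
(* The ultrafilter property: if the ideals containing [a] do not form a set of [F], those missing
   [a] do. *)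
have LC a : ~ L a -> F (avoid [set a]).
  have [//|Fna _] := in_ultra_setVsetC [set K : space | val K a] FU.
  by apply: filterS Fna => K Ka _ ->.
exists (exist _ L (mem_set LP)); split=> /=.
  by move=> a Aa /(filterI FA)/filter_ex[K [/(_ _ Aa)]].
move=> U; rewrite nbhsE => -[O [Oop OL] OU].
have [B [Bfin LB BO]] := open_avoid_sub Oop OL.
apply: (filterS OU); apply: (filterS BO).
by apply: filter_avoid => // b Bb; apply: LC; exact: LB.
Qed.

Lemma proper_bigcap (Z : set space) : Z !=set0 ->
  proper_ideals Q (\bigcap_(J in Z) val J).
Proof.
move=> [K ZK]; apply/proper_idealE; split; first split.
- by exists \bot%O => J _; apply: ideal_bot; exact: (space_proper J).1.
- move=> x y Zx Zy J ZJ; have [[_ join _] _] := space_proper J.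
  by apply: join; [exact: Zx|exact: Zy].
- move=> x l Zx lx J ZJ; have [[_ _ down] _] := space_proper J.
  exact: down (Zx _ ZJ) lx.
- by move=> /(_ _ ZK); have /proper_idealE[] := space_proper K.
Qed.

Lemma sober_proper_ideals : sober space.
Proof.
move=> Z Zcl Zirr; have [Z0 _] := Zirr.
pose G : space := exist _ (\bigcap_(J in Z) val J) (mem_set (proper_bigcap Z0)).
have ZG : Z G.
  (* Otherwise some [avoid A] contains [G] and misses [Z]. Each [a] in [A] is missed by some member
     of [Z]; irreducibility yields one member missing all of [A]. *)
  apply: contrapT => nZG.
  have [A [Afin GA AZ]] := open_avoid_sub (closed_openC Zcl) nZG.
  have FF := irreducible_open_traces Zirr.
  have [O [_ [J [ZJ OJ]]] OA] : open_traces Z (avoid A).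
    apply: filter_avoid => // a Aa.
    exists (avoid [set a]) => //; split.
      by apply: open_avoid1; exact: proper_ideals_sub.
    apply: contrapT => Za0; apply: (GA a Aa) => J ZJ.
    by apply: contrapT => Ja; apply: Za0; exists J; split=> // _ ->.
  by apply: (AZ J) => //; exact: OA.
exists G; split=> [|K]; rewrite (closure1_specialization proper_ideals_sub).
  apply/seteqP; split=> [|K ZK a /(_ K ZK)//].
  rewrite -(closure1_specialization proper_ideals_sub).
  by rewrite [X in _ `<=` X]((closure_id Z).1 Zcl); apply: closureS => _ ->.
(* [K] lies in its own closure [Z], hence includes [G]; [G] lies in that closure, hence includes
   [K]. *)
move=> KZ; apply/val_inj/seteqP; split.
  by move=> a; apply; rewrite -KZ => x.
by move: ZG; rewrite -KZ.
Qed.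

Lemma coherent_basis_proper_ideals : has_coherent_basis space.
Proof.
exists [set avoid A | A in [set A | finite_set A]]; split.
- exact: (basis_avoid proper_ideals_sub).
- by move=> _ [A _ <-]; exact: cover_compact_avoid.
move=> F Ffin FB.
have /choice[g gP] : forall U : set space, exists A : set Q, F U ->
    finite_set A /\ avoid A = U.
  move=> U; have [/FB[A]|nFU] := pselect (F U); first by exists A.
  by exists set0.
exists (\bigcup_(U in F) g U); first by apply: bigcup_finite => // U /gP[].
by rewrite avoid_bigcup; apply: eq_bigcapr => U /gP[].
Qed.

End ProperIdeals.

Theorem theorem5p7 (d : Order.disp_t) (Q : quantaleType d) :
  spectral (quantale_space (proper_ideals Q)).
Proof.
split; last exact: coherent_basis_proper_ideals.
  by rewrite -avoid0; exact: cover_compact_avoid.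
exact: sober_proper_ideals.
Qed.
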